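(* Let $X$ be a normal space. Let $Y$ be a metric topological manifold. Let $n\geq 1$ be an integer. Let $(Z_i)_{1\leq i\leq n}$ be a family of $X$-avoidable closed subsets of $Y$. Then their union $\bigcup_{1\leq i\leq n} Z_i$ is $X$-avoidable.
   Context: A topological space is normal if any two disjoint closed subsets have disjoint neighborhoods. A manifold of dimension $p\in\mathbb{N}$ is a Hausdorff space where every point has a neighborhood homeomorphic to $\mathbb{R}^p$. A metric topological manifold is a metric space whose underlying topological space is a manifold. Avoidability: let $X$ be a topological space, $Y$ a metric space with metric $d$, and $Z\subset Y$. One says that $Z$ is $X$-avoidable (in $Y$) if for any continuous map $f:X\to Y$ and any continuous function $\varepsilon:X\to\mathbb{R}_{>0}$ there exists a continuous map $g:X\to Y$ such that for all $x\in X$, $g(x)\notin Z$ and $d(f(x),g(x))<\varepsilon(x)$. *)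

(* Defs.v *)
From mathcomp Require Export all_boot all_order all_algebra.
From mathcomp Require Export all_classical all_reals all_analysis.
Export numFieldNormedType.Exports.

Set Implicit Arguments.
Unset Strict Implicit.
Unset Printing Implicit Defensive.

Import Order.TTheory GRing.Theory Num.Theory.
Local Open Scope classical_set_scope.
Local Open Scope ring_scope.

Definition homeomorphic (S T : topologicalType) : Prop :=
  exists (f : S -> T) (g : T -> S),
    [/\ continuous f, continuous g, cancel f g & cancel g f].

(* The neighborhood [U] need not be open; [set_type U] is [U] with the
   subspace topology, and ['rV[R]_p] carries the product topology. *)
Definition topological_manifold (R : realType) (p : nat)
    (M : topologicalType) : Prop :=
  hausdorff_space M /\
  forall y : M, exists2 U : set M,
    nbhs y U & homeomorphic (set_type U) 'rV[R]_p.

Definition avoidable (R : realType) (X : topologicalType) (Y : metricType R)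
    (Z : set Y) : Prop :=
  forall (f : X -> Y) (eps : X -> R),
    continuous f -> continuous eps -> (forall x, 0 < eps x) ->
  exists g : X -> Y, continuous g /\
    forall x, ~ Z (g x) /\ mdist (f x) (g x) < eps x.
Arguments avoidable {R} X {Y} Z.

(* Main.v *)
(** If [g] avoids the closed set [A] and [h] is closer to [g] at each point than
    [g] is to [A], then [h] still avoids [A].  As the distance to [A] is
    continuous, it can be built into the tolerance used to push [g] off a second
    avoidable set. *)
Require Import Defs.

Set Implicit Arguments.
Unset Strict Implicit.
Unset Printing Implicit Defensive.

Import Order.TTheory GRing.Theory Num.Theory.
Local Open Scope classical_set_scope.
Local Open Scope ring_scope.

(* The distance to [A], truncated at [1] so that it also makes sense when [A] is
   empty. *)
Definition trunc_dist (R : realType) (Y : metricType R) (A : set Y) (y : Y) : R :=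
  inf (1 |` [set mdist y a | a in A]).

Lemma has_inf_trunc_dist (R : realType) (Y : metricType R) (A : set Y) (y : Y) :
  has_inf (1 |` [set mdist y a | a in A]).
Proof.
split; first by exists 1; left.
by exists 0 => _ [->//|[a _ <-]]; exact: mdist_ge0.
Qed.

Lemma trunc_dist_le1 (R : realType) (Y : metricType R) (A : set Y) (y : Y) :
  trunc_dist A y <= 1.
Proof. by apply: ge_inf; [exact: (has_inf_trunc_dist A y).2 | left]. Qed.

Lemma trunc_dist_le_mdist (R : realType) (Y : metricType R) (A : set Y) (y a : Y) :
  A a -> trunc_dist A y <= mdist y a.
Proof.
by move=> Aa; apply: ge_inf; [exact: (has_inf_trunc_dist A y).2 | right; exists a].
Qed.

(** Every competitor in the infimum at [z], raised by [mdist y z], bounds [trunc_dist A y]: the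
    value [1] by the truncation, [mdist z a] by the triangle inequality. *)
Lemma trunc_dist_lipschitz (R : realType) (Y : metricType R) (A : set Y) (y z : Y) :
  trunc_dist A y <= trunc_dist A z + mdist y z.
Proof.
rewrite -lerBlDr; apply: lb_le_inf; first exact: (has_inf_trunc_dist A z).1.
move=> _ [->|[a Aa <-]]; rewrite lerBlDr.
  by rewrite (le_trans (trunc_dist_le1 A y))// lerDl mdist_ge0.
by rewrite addrC (le_trans (trunc_dist_le_mdist y Aa))// metric_triangle.
Qed.

Lemma continuous_trunc_dist (R : realType) (Y : metricType R) (A : set Y) :
  continuous (trunc_dist A).
Proof.
move=> y; apply/cvgrPdist_lt => e e0; near=> z.
have yze : mdist y z < e.
  by near: z; have := nbhsx_ballx y e e0; rewrite ballEmdist.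
(* The Lipschitz bound, used once in each order of [y] and [z], controls the absolute value. *)
apply: le_lt_trans yze; rewrite ler_norml lerBlDl trunc_dist_lipschitz andbT.
by rewrite lerBrDr addrC lerBlDr metric_sym trunc_dist_lipschitz.
Unshelve. all: by end_near. Qed.

Lemma trunc_dist_gt0 (R : realType) (Y : metricType R) (A : set Y) (y : Y) :
  closed A -> ~ A y -> 0 < trunc_dist A y.
Proof.
move=> cA nAy.
have /nbhs_ballP[e /= e0 eA] : nbhs y (~` A).
  by apply: open_nbhs_nbhs; split => //; exact: closed_openC.
(* A positive lower bound for all competitors: [1] for the truncation, [e] because the [e]-ball
   around [y] misses [A]. *)
apply: (@lt_le_trans _ _ (Num.min 1 e)); first by rewrite lt_min ltr01.
apply: lb_le_inf; first exact: (has_inf_trunc_dist A y).1.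
move=> _ [->|[a Aa <-]]; first by rewrite ge_min lexx.
rewrite ge_min; apply/orP; right; rewrite leNgt; apply/negP => yae.
by have := eA a; rewrite ballEmdist => /(_ yae).
Qed.

Lemma avoidable0 (R : realType) (X : topologicalType) (Y : metricType R) :
  avoidable X (set0 : set Y).
Proof.
by move=> f eps cf _ eps0; exists f; split => // x; split => //; rewrite mdistxx.
Qed.

Lemma avoidableU (R : realType) (X : topologicalType) (Y : metricType R)
    (A B : set Y) :
  closed A -> avoidable X A -> avoidable X B -> avoidable X (A `|` B).
Proof.
move=> cA avA avB f eps cf ceps eps0.
(* The tolerance is split evenly between the two moves, [f] to [g] and [g] to [h]. *)
have ceps2 : continuous (fun x => eps x / 2).
  by move=> x; apply: cvgMr_tmp; exact: ceps.
have eps20 x : 0 < eps x / 2 by rewrite divr_gt0.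
have [g [cg gA]] := avA f _ cf ceps2 eps20.
pose del x := Num.min (eps x / 2) (trunc_dist A (g x)).
have cdel : continuous del.
  move=> x; apply: (@continuous_min R X (fun x => eps x / 2) (trunc_dist A \o g)).
    exact: ceps2.
  by apply: continuous_comp; [exact: cg | exact: continuous_trunc_dist].
have del0 x : 0 < del x.
  by rewrite lt_min eps20 trunc_dist_gt0//; case: (gA x).
have [h [ch hB]] := avB g _ cg cdel del0.
exists h; split => // x; have [nAg fg] := gA x; have [nBh] := hB x.
rewrite lt_min => /andP[gh ghA]; split.
  (* If [h x] were in [A], it would be a point of [A] closer to [g x] than [trunc_dist A (g x)]. *)
  by move=> [Ah|//]; move: ghA; rewrite ltNge trunc_dist_le_mdist.
by rewrite (le_lt_trans (metric_triangle _ (g x) _))// [ltRHS]splitr ltrD.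
Qed.

Theorem proposition3p5 (R : realType) (X : topologicalType)
    (normX : normal_space X)
    (Y : metricType R) (p : nat) (manifY : topological_manifold R p Y)
    (n : nat) (n_ge1 : (1 <= n)%N) (Z : 'I_n -> set Y)
    (closedZ : forall i, closed (Z i))
    (avoidZ : forall i, avoidable X (Z i)) :
  avoidable X (\bigcup_(i in [set: 'I_n]) Z i).
Proof.
have -> : \bigcup_(i in [set: 'I_n]) Z i = \big[setU/set0]_(i < n) Z i.
  rewrite -bigcup_seq; apply: eq_bigcupl.
  by split => // i _ /=; rewrite mem_index_enum.
(* At each step [Z i] is the closed set avoided first and [A], the union built so far, the second
   set, so avoidability alone is a sufficient induction invariant. *)
elim/big_rec : _ => [|i A _ avA]; first exact: avoidable0.
exact: avoidableU.
Qed.
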